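(* Let $k$ be a field, let $f: X \dashrightarrow Y$ be a rational map of affine varieties over $k$, and let $C$ be a Zariski-closed subset of $X$. Then the set-theoretic image $f(C)$ is a constructible subset of $Y$.
   Context: Affine varieties over $k$ are Zariski-closed subsets $X \subseteq \mathbb{A}_k^n$, $Y\subseteq \mathbb{A}_k^m$, taken with their reduced structure (not necessarily irreducible); the underlying topological spaces are the prime spectra of their coordinate rings with the Zariski topology, and $k$ is not assumed to be algebraically closed. A rational map $f$ is given in coordinates by rational functions $b_i = f_i = p_i/q_i$, $i=1,\ldots,m$; for a subset $C \subseteq X$, $f(C)$ denotes the set of images of the points of $C$ at which $f$ is defined (set-theoretic image). A subset of a topological space is locally closed if it is the intersection of an open and a closed subset; it is constructible if it is a finite union of locally closed subsets. *)

(* Defs.v *)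
From HB Require Import structures.
From mathcomp Require Import all_boot all_algebra.
From mathcomp Require Import all_classical.
From mathcomp Require Import topology.
From mathcomp Require Import mpoly ring.

Set Implicit Arguments.
Unset Strict Implicit.
Unset Printing Implicit Defensive.

Import GRing.Theory.
Local Open Scope classical_set_scope.
Local Open Scope ring_scope.
Local Open Scope quotient_scope.

(** * Constructible subsets of a topological space *)

Definition locally_closed (T : topologicalType) (A : set T) : Prop :=
  exists U Z : set T, [/\ open U, closed Z & A = U `&` Z].

Definition constructible (T : topologicalType) (A : set T) : Prop :=
  exists (r : nat) (B : 'I_r -> set T),
    (forall i, locally_closed (B i)) /\ A = \bigcup_i B i.

(** * The prime spectrum with its Zariski topology *)

(* Same data as [prime_idealr R]; a separate record because [set] cannot be
   applied to [prime_idealr R] for lack of room in its universe. *)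
Record spec (R : comNzRingType) := Spec {
  spec_pred : R -> bool;
  spec_idealr : idealr_closed spec_pred;
  spec_prime : prime_idealr_closed spec_pred
}.

Definition spec_mem (R : comNzRingType) (P : spec R) : {pred R} := spec_pred P.
Coercion spec_mem : spec >-> pred_sort.

HB.instance Definition _ (R : comNzRingType) (P : spec R) :=
  isIdealr.Build R (spec_pred P) (@spec_idealr R P).
HB.instance Definition _ (R : comNzRingType) (P : spec R) :=
  isPrimeIdealrClosed.Build R (spec_pred P) (@spec_prime R P).

HB.instance Definition _ (R : comNzRingType) := gen_eqMixin (spec R).
HB.instance Definition _ (R : comNzRingType) := gen_choiceMixin (spec R).

Lemma spec_ext (R : comNzRingType) (P Q : spec R) :
  (forall a, (a \in P) = (a \in Q)) -> P = Q.
Proof.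
case: P Q => [P P1 P2] [Q Q1 Q2] eqPQ.
have {}eqPQ : P = Q by apply: funext => a; exact: (eqPQ a).
by subst Q; f_equal; apply: Prop_irrelevance.
Qed.

Definition zero_locus (R : comNzRingType) (S : set R) : set (spec R) :=
  [set P : spec R | forall a, S a -> a \in P].

Definition zariski_open (R : comNzRingType) (U : set (spec R)) : Prop :=
  exists S : set R, U = ~` zero_locus S.

Section ZariskiTopology.
Variable R : comNzRingType.

Lemma zariski_openT : zariski_open [set: spec R].
Proof.
exists [set 1]; apply/esym/seteqP; split=> // P _ /= /(_ 1 erefl).
by rewrite idealr1.
Qed.

Lemma zariski_openI : setI_closed (@zariski_open R).
Proof.
move=> _ _ [S ->] [S' ->].
exists [set c | exists a b, [/\ S a, S' b & c = a * b]].
rewrite -setCU; congr (~` _); apply/seteqP; split=> P /=.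
  case=> [SP|SP] _ [a [b [Sa Sb ->]]]; rewrite prime_idealrM.
    by apply/orP; left; apply: SP.
  by apply/orP; right; apply: SP.
move=> SSP; apply: contrapT => /not_orP [].
move=> /existsNP [a /not_implyP [Sa /negP aP]].
move=> /existsNP [b /not_implyP [Sb /negP bP]].
have : a * b \in P by apply: SSP; exists a, b.
by rewrite prime_idealrM => /orP [] ?; [case/negP: aP|case/negP: bP].
Qed.

Lemma zariski_open_bigU (I : Type) (f : I -> set (spec R)) :
  (forall i, zariski_open (f i)) -> zariski_open (\bigcup_i f i).
Proof.
move=> /choice [S fE]; exists (\bigcup_i S i).
rewrite (eq_bigcupr (fun i _ => fE i)) -setC_bigcap; congr (~` _).
apply/seteqP; split=> P /=; first by move=> SP a [i _ Sa]; exact: (SP i).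
by move=> SP i _ a Sa; apply: SP; exists i.
Qed.

HB.instance Definition _ := isOpenTopological.Build (spec R)
  zariski_openT zariski_openI zariski_open_bigU.

End ZariskiTopology.

(** * Residue fields *)

(* MathComp only proves that [{ideal_quot P}] has no zero divisors when [P] is
   prime; we add the (classically defined) partial inverse that its integral
   domain structure requires. *)
Definition residue_ring (R : comNzRingType) (P : spec R) : Type :=
  {ideal_quot (spec_pred P : prime_idealr R)}.

Section ResidueField.
Variables (R : comNzRingType) (P : spec R).
Local Notation A := (residue_ring P).

HB.instance Definition _ :=
  GRing.ComNzRing.copy A {ideal_quot (spec_pred P : prime_idealr R)}.

Let unit_pred : pred A := fun a => `[< exists b : A, b * a = 1 >].
Let inv (a : A) : A :=
  if pselect (exists b : A, b * a = 1) is left ab then projT1 (cid ab) else a.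

Let inv_mul : {in unit_pred, left_inverse 1 inv *%R}.
Proof.
move=> a /asboolP ha; rewrite /inv; case: pselect => // ab.
exact: projT2 (cid ab).
Qed.

Let unit_mul (a b : A) : b * a = 1 -> unit_pred a.
Proof. by move=> ba; apply/asboolP; exists b. Qed.

Let inv_out : {in [predC unit_pred], inv =1 id}.
Proof.
by move=> a; rewrite inE => /asboolPn na; rewrite /inv; case: pselect.
Qed.

HB.instance Definition _ :=
  GRing.ComNzRing_hasMulInverse.Build A inv_mul unit_mul inv_out.

Let residue_integral : GRing.integral_domain_axiom A.
Proof. exact: (@Quotient.rquot_IdomainAxiom R P). Qed.

HB.instance Definition _ :=
  GRing.ComUnitRing_isIntegral.Build A residue_integral.

Definition residue_field : fieldType := {fraction A}.

Definition residue_proj (a : R) : A :=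
  \pi_{ideal_quot (spec_pred P : prime_idealr R)} a.

HB.instance Definition _ := GRing.RMorphism.copy residue_proj
  (\pi_{ideal_quot (spec_pred P : prime_idealr R)} :
    R -> {ideal_quot (spec_pred P : prime_idealr R)}).

Definition residue (a : R) : residue_field := FracField.tofrac (residue_proj a).

HB.instance Definition _ := GRing.RMorphism.copy residue
  (@FracField.tofrac A \o residue_proj).

Lemma residue_eq0 (a : R) : (residue a == 0) = (a \in P).
Proof.
rewrite [residue a == 0]tofrac_eq0 [residue_proj a == 0]piE.
by rewrite Quotient.equivE subr0.
Qed.

End ResidueField.

(** * Kernels of ring morphisms to a field *)

Definition kernel (R : comNzRingType) (K : fieldType) (phi : R -> K)
 : {pred R} :=
  fun a => phi a == 0.

Section Kernel.
Variables (R : comNzRingType) (K : fieldType) (phi : {rmorphism R -> K}).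

Let kernel_idealr : idealr_closed (kernel phi).
Proof.
split; rewrite ?unfold_in /kernel ?rmorph0 ?rmorph1 ?oner_eq0 //.
move=> a u v; rewrite !unfold_in /kernel rmorphD rmorphM.
by move=> /eqP -> /eqP ->; rewrite mulr0 addr0.
Qed.

Let kernel_prime : prime_idealr_closed (kernel phi).
Proof. by move=> u v; rewrite !unfold_in /kernel rmorphM mulf_eq0. Qed.

Definition kernel_point : spec R := Spec kernel_idealr kernel_prime.

End Kernel.

(** * Affine space, rational functions and rational maps *)

Definition affine_space (k : fieldType) (n : nat) : topologicalType :=
  spec {mpoly k[n]}.

(* The ideal I(X); k[x_1, ..., x_n] / I(X) is the coordinate ring of X with its
   reduced structure. *)
Definition vanishing (k : fieldType) (n : nat) (X : set (affine_space k n))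
  : set {mpoly k[n]} :=
  [set g | forall P, X P -> g \in P].

(* A fraction of the coordinate ring of X, given by polynomial representatives
   of its numerator and denominator. As X may be reducible, the denominator is
   required to be a nonzerodivisor of the coordinate ring, i.e. not to vanish
   identically on any irreducible component of X. *)
Record fraction_on (k : fieldType) (n : nat) (X : set (affine_space k n)) :=
  FractionOn {
    num : {mpoly k[n]};
    den : {mpoly k[n]};
    den_regular : forall h, vanishing X (den * h) -> vanishing X h
  }.

(* Equality in the total ring of fractions of the coordinate ring of X. *)
Definition same_function (k : fieldType) (n : nat) (X : set (affine_space k n))
    (b c : fraction_on X) : Prop :=
  vanishing X (num b * den c - num c * den b).

(* [b] is defined at the point [P] with value [v] in the residue field of [P].
   Any fraction equal to [b] may be used, so that the domain of definition does
   not depend on the chosen representative. *)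
Definition has_value (k : fieldType) (n : nat) (X : set (affine_space k n))
    (b : fraction_on X) (P : affine_space k n) (v : residue_field P) : Prop :=
  exists c : fraction_on X, [/\ same_function b c,
    den c \notin P
    & v = residue P (num c) / residue P (den c)].

Lemma has_value_unique (k : fieldType) (n : nat) (X : set (affine_space k n))
    (b : fraction_on X) (P : affine_space k n) (v w : residue_field P) :
  X P -> has_value b v -> has_value b w -> v = w.
Proof.
move=> XP [c [bc cP ->]] [d [bd dP ->]].
have : vanishing X (den b * (num c * den d - num d * den c)).
  move=> Q XQ; have := rpredB (idealMr (den c) (bd Q XQ))
                              (idealMr (den d) (bc Q XQ)).
  by congr (_ \in Q); ring.
move=> /den_regular /(_ P XP) cd.
apply/eqP; rewrite eqr_div ?residue_eq0 // -!rmorphM -subr_eq0 -rmorphB.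
by rewrite residue_eq0.
Qed.

(* The point with coordinates [v] in the field [K]: the kernel of the morphism
   of k-algebras sending the i-th variable to [v i]. *)
Definition point_of (k K : fieldType) (iota : {rmorphism k -> K}) (m : nat)
    (v : 'I_m -> K) : affine_space k m :=
  kernel_point (mmap iota v).

Definition residue_scalar (k : fieldType) (n : nat) (P : affine_space k n)
  : {rmorphism k -> residue_field P} := residue P \o @mpolyC n k.

(* [maps_to b P Q]: every coordinate of [b] is defined at [P], and [Q] is the
   image of [P]. *)
Definition maps_to (k : fieldType) (n m : nat) (X : set (affine_space k n))
    (b : 'I_m -> fraction_on X) (P : affine_space k n) (Q : affine_space k m)
  : Prop :=
  exists v : 'I_m -> residue_field P,
    (forall i, has_value (b i) (v i)) /\ Q = point_of (residue_scalar P) v.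

Record rational_map (k : fieldType) (n m : nat)
    (X : set (affine_space k n)) (Y : set (affine_space k m)) := RationalMap {
  coords :> 'I_m -> fraction_on X;
  coords_in : forall P Q, X P -> maps_to coords P Q -> Y Q
}.

Definition rational_image (k : fieldType) (n m : nat)
    (X : set (affine_space k n)) (Y : set (affine_space k m))
    (f : rational_map X Y) (C : set X) : set Y :=
  [set y : Y | exists x : X, C x /\ maps_to f (\val x) (\val y)].

(* Main.v *)
(* Chevalley's theorem for morphisms of finite type over a field.  The domain of f
   is the union of the open sets on which some tuple of representatives p_i / q_i
   has all its denominators nonzero; k[x_1, ..., x_n] being Noetherian, finitely
   many tuples suffice and C is cut out by finitely many polynomials.  For one
   tuple, f(C) is the projection to the y-space of the graph given by the
   equations of C, q_i(x) y_i = p_i(x) and the inequation prod q_i(x) <> 0, so it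
   suffices to eliminate one variable x from p_1 = ... = p_r = 0, q <> 0.
   Splitting the base according to whether a leading coefficient vanishes either
   shortens one p_j or allows a pseudo-division step, until at most one p is left,
   with invertible leading coefficient; then the fibre is nonempty iff p does not
   divide a high power of q, which is read off the pseudo-remainder. *)

Require Import Defs.
From mathcomp Require Import all_boot all_algebra.
From mathcomp Require Import all_classical.
From mathcomp Require Import topology.
From mathcomp Require Import mpoly ring zify.

Set Implicit Arguments.
Unset Strict Implicit.
Unset Printing Implicit Defensive.

Import GRing.Theory.
Local Open Scope classical_set_scope.
Local Open Scope ring_scope.

(** * Noetherian rings *)

Definition is_ideal (R : comNzRingType) (I : set R) : Prop :=
  I 0 /\ forall a u v, I u -> I v -> I (a * u + v).

(** Intersection of all ideals containing [S]: membership is used by exhibiting an ideal, without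
    linear combinations. *)
Definition ideal_span (R : comNzRingType) (S : set R) : set R :=
  [set a | forall I, is_ideal I -> S `<=` I -> I a].

Definition noetherian (R : comNzRingType) : Prop :=
  forall I : set R, is_ideal I ->
    exists2 s : seq R, [set` s] `<=` I & I `<=` ideal_span [set` s].

Section Ideals.
Variable R : comNzRingType.
Implicit Types I S : set R.

Lemma idealD I u v : is_ideal I -> I u -> I v -> I (u + v).
Proof. by move=> [_ h] Iu Iv; rewrite -[u]mul1r; apply: h. Qed.

Lemma idealM I a u : is_ideal I -> I u -> I (a * u).
Proof. by move=> [h0 h] Iu; rewrite -[a * u]addr0; apply: h. Qed.

Lemma idealB I u v : is_ideal I -> I u -> I v -> I (u - v).
Proof.
move=> hI Iu Iv; apply: idealD => //.
by rewrite -mulN1r; apply: idealM.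
Qed.

Lemma ideal_span_ideal S : is_ideal (ideal_span S).
Proof.
split=> [I [] //|a u v Su Sv I hI SI].
by apply: hI.2; [apply: Su|apply: Sv].
Qed.

Lemma sub_ideal_span S : S `<=` ideal_span S.
Proof. by move=> a Sa I _; apply. Qed.

Lemma ideal_span_min S I : is_ideal I -> S `<=` I -> ideal_span S `<=` I.
Proof. by move=> hI SI a; apply. Qed.

Lemma ideal_spanS S S' : S `<=` S' -> ideal_span S `<=` ideal_span S'.
Proof.
move=> SS'; apply: ideal_span_min; first exact: ideal_span_ideal.
by move=> a /SS'; apply: sub_ideal_span.
Qed.

Lemma ideal_span_catl (s s' : seq R) :
  ideal_span [set` s] `<=` ideal_span [set` s ++ s'].
Proof. by apply: ideal_spanS => a /= as_; rewrite mem_cat [a \in s]as_. Qed.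

Lemma ideal_span_catr (s s' : seq R) :
  ideal_span [set` s'] `<=` ideal_span [set` s ++ s'].
Proof. by apply: ideal_spanS => a /= as_; rewrite mem_cat [a \in s']as_ orbT. Qed.

Lemma spec_ideal (P : spec R) : is_ideal [set a | a \in P].
Proof.
split=> /=; first exact: rpred0.
by move=> a u v uP vP; rewrite rpredD // idealMr.
Qed.

(** The elements in the span of a finite part of [S] form an ideal containing [S], so finitely many
    elements of [S] suffice for each of the finitely many generators of its span. *)
Lemma noetherian_subset S : noetherian R ->
  exists2 s : seq R, [set` s] `<=` S & S `<=` ideal_span [set` s].
Proof.
move=> noeR; have [t tS St] := noeR _ (ideal_span_ideal S).
have finite_type a : ideal_span S a ->
    exists2 s : seq R, [set` s] `<=` S & ideal_span [set` s] a.
  move=> /(_ [set a | exists2 s : seq R, [set` s] `<=` S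
                        & ideal_span [set` s] a]); apply.
    split=> [|b u v [s sS us] [s' sS' vs']].
      by exists [::] => //; case: (ideal_span_ideal [set` [::]]).
    exists (s ++ s').
      by move=> c /=; rewrite mem_cat => /orP [/sS|/sS'].
    have [_ h] := ideal_span_ideal [set` s ++ s']; apply: h.
      exact: ideal_span_catl.
    exact: ideal_span_catr.
  move=> b Sb; exists [:: b]; first by move=> c /=; rewrite inE => /eqP ->.
  by apply: sub_ideal_span; rewrite /= inE.
have [s sS ts] : exists2 s : seq R, [set` s] `<=` S
    & [set` t] `<=` ideal_span [set` s].
  elim: t tS {St} => [|b t IHt] tS; first by exists [::].
  have [c ct|s sS ts] := IHt; first by apply: tS; rewrite /= inE [c \in t]ct orbT.
  have [|s' sS' bs'] := finite_type b; first by apply: tS; rewrite /= inE eqxx.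
  exists (s' ++ s) => c; first by rewrite /= mem_cat => /orP [/sS'|/sS].
  rewrite /= inE => /orP [/eqP -> {c}|ct].
    exact: ideal_span_catl.
  by apply: ideal_span_catr; apply: ts.
exists s => // a /sub_ideal_span/St; apply: ideal_span_min => //.
exact: ideal_span_ideal.
Qed.

End Ideals.

Lemma noetherian_field (k : fieldType) : noetherian k.
Proof.
move=> I hI; have [[a Ia a0]|I0] := pselect (exists2 a, I a & a != 0).
  exists [:: a]; first by move=> b; rewrite /= inE => /eqP ->.
  move=> b _; rewrite -[b](mulfVK a0).
  apply: (@idealM k _ _ _ (ideal_span_ideal _)).
  by apply: sub_ideal_span; rewrite /= inE.
exists [::] => // b Ib; have [->|b0] := eqVneq b 0.
  exact: (ideal_span_ideal _).1.
by case: I0; exists b.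
Qed.

Lemma noetherian_surj (R S : comNzRingType) (f : {rmorphism R -> S}) :
  (forall b, exists a, f a = b) -> noetherian R -> noetherian S.
Proof.
move=> fsurj noeR I hI.
have [|s sI Is] := noeR [set a | I (f a)].
  split=> /= [|a u v Iu Iv]; first by rewrite rmorph0; exact: hI.1.
  by rewrite rmorphD rmorphM; apply: hI.2.
exists (map f s); first by move=> _ /= /mapP [a /sI Ia ->].
move=> b Ib J hJ sJ; have [a fa] := fsurj b; rewrite -fa in Ib *.
apply: (Is _ Ib [set a | J (f a)]).
  split=> /= [|c u v Ju Jv]; first by rewrite rmorph0; exact: hJ.1.
  by rewrite rmorphD rmorphM; apply: hJ.2.
by move=> c cs; apply: sJ; apply/mapP; exists c.
Qed.

(** * Hilbert's basis theorem *)

Section HilbertBasis.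
Variable R : comNzRingType.

(** The size is only bounded above, so that sums whose leading terms cancel are covered and the set
    is an ideal. *)
Definition top_coefs (J : set {poly R}) (d : nat) : set R :=
  [set a | exists f : {poly R}, [/\ J f, (size f <= d.+1)%N & f`_d = a]].

Lemma top_coefs_ideal J d : is_ideal J -> is_ideal (top_coefs J d).
Proof.
move=> hJ; split.
  by exists 0; rewrite size_poly0 coef0; split=> //; exact: hJ.1.
move=> a _ _ [f [Jf sf <-]] [g [Jg sg <-]]; exists (a%:P * f + g); split.
- exact: hJ.2.
- rewrite mul_polyC (leq_trans (size_polyD _ _)) // geq_max sg andbT.
  exact: leq_trans (size_scale_leq _ _) sf.
- by rewrite coefD coefCM.
Qed.

Lemma top_coefs_shift J d e a : is_ideal J -> top_coefs J d a ->
  exists2 f : {poly R}, J f & (size f <= (e + d).+1)%N /\ f`_(e + d) = a.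
Proof.
move=> hJ [f [Jf sf <-]]; exists ('X^e * f); first exact: idealM.
split; last by rewrite coefXnM ltnNge leq_addr /= addKn.
rewrite (leq_trans (size_polyMleq _ _)) // size_polyXn addSn /=.
by rewrite -addnS leq_add2l.
Qed.

Lemma top_coefs_homo J d e : is_ideal J -> (d <= e)%N ->
  top_coefs J d `<=` top_coefs J e.
Proof.
move=> hJ de a /(top_coefs_shift (e - d) hJ) [f Jf].
by rewrite subnK // => -[sf fa]; exists f.
Qed.

(* [top_coefs J d] increases with [d], hence is stationary from some [D] on:
   J is generated by lifts of generators of [top_coefs J d] for d <= D. *)
Lemma noetherian_poly : noetherian R -> noetherian {poly R}.
Proof.
move=> noeR J hJ.
have [D topD] : exists D, forall d, top_coefs J d `<=` top_coefs J D.
  have [|s sL Ls] := noeR [set a | exists d, top_coefs J d a].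
    split; first by exists 0%N; exact: (top_coefs_ideal 0 hJ).1.
    move=> a u v [d du] [e ev]; exists (maxn d e).
    apply: (top_coefs_ideal _ hJ).2.
      by apply: top_coefs_homo du => //; rewrite leq_maxl.
    by apply: top_coefs_homo ev => //; rewrite leq_maxr.
  have [D sD] : exists D, [set` s] `<=` top_coefs J D.
    elim: s sL {Ls} => [|a s IHs] sL; first by exists 0%N.
    have [b bs|D sD] := IHs; first by apply: sL; rewrite /= inE [b \in s]bs orbT.
    have [|d da] := sL a; first by rewrite /= inE eqxx.
    exists (maxn d D) => b; rewrite /= inE => /orP [/eqP ->|/sD].
      by apply: top_coefs_homo da => //; rewrite leq_maxl.
    by apply: top_coefs_homo => //; rewrite leq_maxr.
  exists D => d a da; apply: (ideal_span_min (top_coefs_ideal D hJ) sD).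
  by apply: Ls; exists d.
have gens d : exists F : seq {poly R}, [set` F] `<=` J /\
    top_coefs J d `<=` top_coefs (ideal_span [set` F]) d.
  have [s sJ Js] := noeR _ (top_coefs_ideal d hJ).
  have [F [FJ sF]] : exists F : seq {poly R}, [set` F] `<=` J /\
      [set` s] `<=` top_coefs (ideal_span [set` F]) d.
    elim: s sJ {Js} => [|a s IHs] sJ; first by exists [::]; split.
    have [b bs|F [FJ sF]] := IHs.
      by apply: sJ; rewrite /= inE [b \in s]bs orbT.
    have [|f [Jf sf fa]] := sJ a; first by rewrite /= inE eqxx.
    exists (f :: F); split=> [g|b]; first by rewrite /= inE => /orP [/eqP ->|/FJ].
    rewrite /= inE => /orP [/eqP ->|/sF [g [Fg sg gb]]].
      by exists f; split=> //; apply: sub_ideal_span; rewrite /= inE eqxx.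
    exists g; split=> //; exact: (@ideal_span_catr _ [:: f]).
  exists F; split=> // a /Js; apply: (ideal_span_min _ sF).
  exact: (top_coefs_ideal _ (ideal_span_ideal _)).
have {}gens d : exists F : seq {poly R}, [set` F] `<=` J /\
    forall e, (e < d)%N -> top_coefs J e `<=` top_coefs (ideal_span [set` F]) e.
  elim: d => [|d [F [FJ JF]]]; first by exists [::].
  have [G [GJ JG]] := gens d; exists (F ++ G); split=> [g|e].
    by rewrite /= mem_cat => /orP [/FJ|/GJ].
  rewrite ltnS leq_eqVlt => /orP [/eqP ->|/JF {}JF] a.
    move=> /JG [f [Gf sf fa]]; exists f; split=> //.
    exact: ideal_span_catr.
  move=> /JF [f [Gf sf fa]]; exists f; split=> //.
  exact: ideal_span_catl.
have [F [FJ JF]] := gens D.+1; exists F => // f.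
have spanJ := ideal_span_min hJ FJ.
(* Subtracting some [g] of the span with the same coefficient in degree [d] lowers the bound on the
   size. For [d > D], [g] is ['X^(d - D)] times an element found in degree [D]. *)
elim: {f}(size f) {-2}f (leqnn (size f)) => [|d IHd] f.
  by rewrite leqn0 size_poly_eq0 => /eqP -> _; exact: (ideal_span_ideal _).1.
move=> sf Jf; have [g Fg [sg gd]] : exists2 g, ideal_span [set` F] g &
    (size g <= d.+1)%N /\ g`_d = f`_d.
  have fd : top_coefs J d f`_d by exists f.
  have [dD|Dd] := leqP d D; first by have [//|g [? ? ?]] := JF d _ _ fd; exists g.
  have /(top_coefs_shift (d - D) (ideal_span_ideal _)) :=
    JF D (leqnn _) _ (topD d _ fd).
  by rewrite subnK // ltnW.
rewrite -[f](subrK g); apply: (@idealD {poly R} _ _ _ (ideal_span_ideal _)) => //.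
apply: IHd; last by apply: idealB => //; exact: spanJ.
apply/leq_sizeP => j; rewrite leq_eqVlt => /orP [/eqP <-|dj].
  by rewrite coefB gd subrr.
rewrite coefB !nth_default ?subrr //; exact: leq_trans dj.
Qed.

End HilbertBasis.

(** * Contraction of prime ideals and finitely presented constructible sets *)

Section Contraction.
Variables (R S : comNzRingType) (f : {rmorphism R -> S}) (P : spec S).

Definition contraction_pred : R -> bool := fun a => f a \in P.

Let mem_pred a : (a \in contraction_pred) = (f a \in P).
Proof. by []. Qed.

Lemma contraction_idealr : idealr_closed contraction_pred.
Proof.
split; rewrite ?mem_pred ?rmorph0 ?rmorph1 ?rpred0 ?idealr1 //.
move=> a u v; rewrite !mem_pred rmorphD rmorphM => uP vP.
by rewrite rpredD // idealMr.
Qed.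

Lemma contraction_prime : prime_idealr_closed contraction_pred.
Proof. by move=> u v; rewrite !mem_pred rmorphM prime_idealrM. Qed.

Definition contraction : spec R := Spec contraction_idealr contraction_prime.

Lemma mem_contraction a : (a \in contraction) = (f a \in P).
Proof. by []. Qed.

End Contraction.

Definition basic (R : comNzRingType) (s : seq R) (q : R) : set (spec R) :=
  [set P : spec R | (forall a, a \in s -> a \in P) /\ q \notin P].

(** Only finitely many equations are allowed: elimination proceeds by induction on their sizes,
    while a closed set over a general ring may require infinitely many. *)
Inductive fin_constructible (R : comNzRingType) : set (spec R) -> Prop :=
| fin_constructible_basic s q : fin_constructible (basic s q)
| fin_constructibleU A B : fin_constructible A -> fin_constructible B ->
    fin_constructible (A `|` B).

Section FinConstructible.
Variable R : comNzRingType.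
Implicit Types (A B : set (spec R)) (P : spec R) (s : seq R) (a q : R).

Lemma fin_constructible0 : fin_constructible (@set0 (spec R)).
Proof.
have -> : set0 = basic [::] (0 : R); last exact: fin_constructible_basic.
by apply/esym; rewrite -subset0 => P [_]; rewrite rpred0.
Qed.

Lemma fin_constructibleI_closed a A : fin_constructible A ->
  fin_constructible (A `&` [set P : spec R | a \in P]).
Proof.
elim=> [s q|{}A B _ hA _ hB]; last by rewrite setIUl; exact: fin_constructibleU.
have -> : basic s q `&` [set P : spec R | a \in P] = basic (a :: s) q.
  apply/seteqP; split=> P /= [].
    by move=> [sP qP] aP; split=> // b; rewrite inE => /orP [/eqP ->|/sP].
  move=> sP qP; split; last by apply: sP; rewrite inE eqxx.
  by split=> // b bs; apply: sP; rewrite inE bs orbT.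
exact: fin_constructible_basic.
Qed.

Lemma fin_constructibleI_open a A : fin_constructible A ->
  fin_constructible (A `&` [set P : spec R | a \notin P]).
Proof.
elim=> [s q|{}A B _ hA _ hB]; last by rewrite setIUl; exact: fin_constructibleU.
have -> : basic s q `&` [set P : spec R | a \notin P] = basic s (q * a).
  apply/seteqP; rewrite /basic; split=> P /=; rewrite prime_idealrM negb_or.
    by move=> [[sP qP] aP]; rewrite qP aP.
  by move=> [sP /andP [-> ->]].
exact: fin_constructible_basic.
Qed.

Lemma fin_constructible_bigU (I : eqType) (r : seq I) (F : I -> set (spec R)) :
  (forall i, fin_constructible (F i)) ->
  fin_constructible [set P : spec R | exists2 i, i \in r & F i P].
Proof.
move=> hF; elim: r => [|i r IHr].
  have -> : [set P : spec R | exists2 i, i \in [::] & F i P] = set0.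
    by rewrite -subset0 => P [].
  exact: fin_constructible0.
have -> : [set P : spec R | exists2 j, j \in i :: r & F j P]
    = F i `|` [set P : spec R | exists2 i, i \in r & F i P].
  apply/seteqP; split=> P /=.
    move=> [j]; rewrite inE => /orP [/eqP ->|jr] Fj; first by left.
    by right; exists j.
  move=> [Fi|[j jr Fj]]; first by exists i => //; rewrite inE eqxx.
  by exists j => //; rewrite inE jr orbT.
exact: fin_constructibleU.
Qed.

(** This is the locus where [f] stays nonzero over the residue field; coefficients beyond the size
    are 0 and lie in every prime. *)
Lemma fin_constructible_coefs (f : {poly R}) :
  fin_constructible [set P : spec R | exists i, f`_i \notin P].
Proof.
have -> : [set P : spec R | exists i, f`_i \notin P]
    = [set P : spec R | exists2 c, c \in (f : seq R) & basic [::] c P].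
  apply/seteqP; split=> P /=; last first.
    by move=> [c /(nthP 0) [i _ <-] [_ cP]]; exists i.
  move=> [i fiP]; exists f`_i; last by split.
  apply: mem_nth; rewrite ltnNge; apply: contra fiP => fi.
  by rewrite nth_default // rpred0.
by apply: fin_constructible_bigU => c; exact: fin_constructible_basic.
Qed.

End FinConstructible.

(** * Points of the affine line over a prime of the base *)

Lemma mem_spec_poly (R : comNzRingType) (P : spec {poly R}) (f : {poly R}) :
  (forall i, (f`_i)%:P \in P) -> f \in P.
Proof.
move=> fP; rewrite -[f]coefK poly_def rpred_sum // => i _.
by rewrite -mul_polyC mulrC idealMr.
Qed.

Section PointOver.
Variables (R : comNzRingType) (K : fieldType) (phi : {rmorphism R -> K}).
Variable d : {poly K}.
Hypothesis d_nonunit : size d != 1.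
Hypothesis d_prime : forall u v, d %| u * v -> (d %| u) || (d %| v).

(** Pulls back to [{poly R}] a closed point of the line over [K] when [d] is irreducible, and the
    generic point when [d = 0]. *)
Definition point_over_pred : {poly R} -> bool :=
  fun f => d %| map_poly phi f.

Let mem_pred (f : {poly R}) : (f \in point_over_pred) = (d %| map_poly phi f).
Proof. by []. Qed.

Lemma point_over_idealr : idealr_closed point_over_pred.
Proof.
split; rewrite ?mem_pred ?rmorph0 ?rmorph1 ?dvdp0 ?dvdp1 //.
move=> a u v; rewrite !mem_pred rmorphD rmorphM => du dv.
by rewrite dvdp_add // dvdp_mull.
Qed.

Lemma point_over_prime : prime_idealr_closed point_over_pred.
Proof. by move=> u v; rewrite !mem_pred rmorphM; exact: d_prime. Qed.

Definition point_over : spec {poly R} := Spec point_over_idealr point_over_prime.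

(** The non-unit [d] divides a constant only if that constant is 0. *)
Lemma contraction_point_over :
  contraction (@polyC R) point_over = kernel_point phi.
Proof.
apply: spec_ext => a; rewrite mem_contraction.
rewrite -[LHS]/(d %| map_poly phi a%:P) -[RHS]/(phi a == 0) map_polyC /=.
have [->|d_neq0] := eqVneq d 0; first by rewrite dvd0p polyC_eq0.
have [->|fa0] := eqVneq (phi a) 0; first by rewrite dvdp0.
apply/negP => /dvdp_leq; rewrite polyC_eq0 fa0 size_polyC fa0 => /(_ isT).
by move: d_nonunit d_neq0; rewrite -size_poly_eq0; case: size => [|[]].
Qed.

End PointOver.

Lemma irreducible_factor (K : fieldType) (g : {poly K}) :
  (1 < size g)%N -> exists2 d, irreducible_poly d & d %| g.
Proof.
elim: {g}(size g) {-2}g (leqnn (size g)) => [|n IHn] g; first by case: size.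
move=> sg g1; have [irr|] := pselect (irreducible_poly g).
  by exists g.
move=> nirr; have [d [sd dg ndg]] : exists d : {poly K},
    [/\ size d != 1, d %| g & ~~ (d %= g)].
  apply: contrapT => nd; apply: nirr; split=> // d sd dg.
  by apply: contrapT => /negP ndg; apply: nd; exists d.
have g0 : g != 0 by rewrite -size_poly_gt0 ltnW.
have d0 : d != 0 by apply: contraTneq dg => ->; rewrite dvd0p.
have [||e irr_e ed] := IHn d.
- rewrite -ltnS; apply: leq_trans sg; rewrite ltn_neqAle dvdp_leq // andbT.
  by rewrite (dvdp_size_eqp dg).
- by move: d0 sd; rewrite -size_poly_eq0; case: size => [|[]].
by exists e => //; exact: dvdp_trans dg.
Qed.

Lemma irreducible_prime (K : fieldType) (d : {poly K}) : irreducible_poly d ->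
  forall u v, d %| u * v -> (d %| u) || (d %| v).
Proof.
move=> irr u v duv; have [//|ndu] := boolP (d %| u).
rewrite -(Gauss_dvdpr v (_ : coprimep d u)) //.
apply: contraR ndu => ncop; have := irr _ ncop (dvdp_gcdl _ _).
by move/eqp_dvdl => <-; exact: dvdp_gcdr.
Qed.

Lemma mem_kernel (R : comNzRingType) (K : fieldType)
    (phi : {rmorphism R -> K}) a :
  (a \in kernel_point phi) = (phi a == 0).
Proof. by []. Qed.

Lemma contraction_kernel (R S : comNzRingType) (K : fieldType)
    (f : {rmorphism R -> S}) (psi : {rmorphism S -> K})
    (phi : {rmorphism R -> K}) :
  (forall a, psi (f a) = phi a) ->
  contraction f (kernel_point psi) = kernel_point phi.
Proof.
by move=> psif; apply: spec_ext => a; rewrite mem_contraction !mem_kernel psif.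
Qed.

Lemma kernel_residue (R : comNzRingType) (Q : spec R) :
  kernel_point (residue Q) = Q.
Proof. by apply: spec_ext => a; exact: residue_eq0. Qed.

(** * Elimination of one variable *)

Section LineProjection.
Variable R : comNzRingType.
Implicit Types (s : seq {poly R}) (p q : {poly R}) (a : R).

Let proj s q : set (spec R) := contraction (@polyC R) @` basic s q.

(** Whether a prime contains the constant [a] depends only on its contraction, so the equations may
    be replaced by equivalent ones over each half of the base. *)
Lemma proj_basic_split a s s1 s2 q :
    (forall P : spec {poly R}, a%:P \in P -> basic s q P <-> basic s1 q P) ->
    (forall P : spec {poly R}, a%:P \notin P -> basic s q P <-> basic s2 q P) ->
  proj s q = (proj s1 q `&` [set Q : spec R | a \in Q])
    `|` (proj s2 q `&` [set Q : spec R | a \notin Q]).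
Proof.
move=> h1 h2; apply/seteqP; split=> [_ [P sP <-]|_ [[[P sP <-]]|[[P sP <-]]]].
- have [aP|aP] := boolP (a%:P \in P); [left|right]; split=> //;
    by exists P => //; apply/h1 || apply/h2.
- by rewrite /= mem_contraction => aP; exists P => //; apply/h1.
- by rewrite /= mem_contraction => aP; exists P => //; apply/h2.
Qed.

(** The fibre over [Q] is a whole line; if [q] is nonzero over the residue field, the generic point
    of that line, given by [d = 0], avoids [q]. *)
Lemma proj_basic_nil q : proj [::] q = [set Q : spec R | exists i, q`_i \notin Q].
Proof.
apply/seteqP; split=> [_ [P [_ qP] <-]|Q [i qi]] /=.
  apply: contrapT => nq; case/negP: qP; apply: mem_spec_poly => i.
  by apply: contrapT => /negP qi; apply: nq; exists i.
have d1 : size (0 : {poly residue_field Q}) != 1 by rewrite size_poly0.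
have d_prime (u v : {poly residue_field Q}) : 0 %| u * v -> (0 %| u) || (0 %| v).
  by rewrite !dvd0p mulf_eq0.
exists (point_over (residue Q) d1 d_prime); last first.
  by rewrite contraction_point_over kernel_residue.
split=> //; rewrite -[_ \in _]/(0 %| _) dvd0p.
apply: contra qi => /eqP /polyP /(_ i); rewrite coef_map coef0 /=.
by move/eqP; rewrite residue_eq0.
Qed.

(** [gdcop q p] is the largest divisor of [p] coprime to [q]. Were it constant, [p] would divide
    [q ^+ size p]; hence it has an irreducible factor, which cannot divide [q]. *)
Lemma prime_of_ndvdp (K : fieldType) (p q : {poly K}) :
    p != 0 -> ~~ (p %| q ^+ size p) ->
  exists2 d, irreducible_poly d & (d %| p) && ~~ (d %| q).
Proof.
move=> p0 npq; have q0 : q != 0.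
  apply: contraNneq npq => ->; rewrite expr0n size_poly_eq0 (negPf p0).
  exact: dvdp0.
have g0 : gdcop q p != 0.
  by apply: contraTneq (dvdp_gdco q p) => ->; rewrite dvd0p.
have /irreducible_factor [d irr_d dg] : (1 < size (gdcop q p))%N.
  rewrite ltnNge; apply: contra npq => g1.
  have := dvdp_gdcor p q0; rewrite (size1_polyC g1) mul_polyC dvdpZr //.
  by apply: contraNneq g0 => g00; rewrite (size1_polyC g1) g00.
exists d => //; rewrite (dvdp_trans dg (dvdp_gdco _ _)) /=.
apply/negP => dq; have := coprimep_gdco q p0.
move/coprimepP => /(_ d dg dq); rewrite -size_poly_eq1 => /eqP sd.
by case: irr_d; rewrite sd.
Qed.

(* Dividing [q ^+ size p] by [p] leaves the remainder [r]; when [lead_coef p] is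
   not in Q, the fibre over Q contains a point of V(p) outside V(q) iff [p] does
   not divide [q ^+ size p] over the residue field, i.e. iff [r] is nonzero. *)
Lemma proj_basic_single p q : p != 0 ->
  proj [:: p] q `&` [set Q : spec R | lead_coef p \notin Q]
    = [set Q : spec R | exists i, (Pdiv.Ring.rmodp (q ^+ size p) p)`_i \notin Q]
      `&` [set Q : spec R | lead_coef p \notin Q].
Proof.
move=> p0; have := Pdiv.ComRing.rdivp_eq p (q ^+ size p).
set r := Pdiv.Ring.rmodp _ _; set h := Pdiv.Ring.rdivp _ _.
set M := Pdiv.Ring.rscalp _ _.
move=> div_eq.
have sr : (size r < size p)%N by rewrite Pdiv.Ring.ltn_rmodp.
apply/seteqP; split=> Q /= [].
  move=> [P [pP qP] <-]; rewrite mem_contraction => aP; split=> //.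
  apply: contrapT => nr; have rP : r \in P.
    apply: mem_spec_poly => i; apply: contrapT => /negP ri; apply: nr.
    by exists i.
  (* With [p] and [r] in [P], pseudo-division puts into [P] a product of powers of [lead_coef p] and
     [q], neither of which is in [P]. *)
  have : lead_coef p ^+ M *: q ^+ size p \in P.
    by rewrite div_eq rpredD // idealMr // pP // inE.
  rewrite -mul_polyC prime_idealrM polyC_exp.
  have exp_notin (u : {poly R}) e : u \notin P -> u ^+ e \notin P.
    move=> uP; elim: e => [|e IHe]; first by rewrite expr0 idealr1.
    by rewrite exprS prime_idealrM negb_or uP.
  by rewrite (negPf (exp_notin _ _ aP)) (negPf (exp_notin _ _ qP)).
move=> [i ri] aQ; split=> //.
set phi := map_poly (residue Q).
have phia : residue Q (lead_coef p) != 0 by rewrite residue_eq0.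
have sphip : size (phi p) = size p
  by rewrite /phi size_poly_eq // size_map_poly_id0.
have phip0 : phi p != 0 by rewrite -size_poly_eq0 sphip size_poly_eq0.
(* Otherwise [phi p] would divide [phi r], which is nonzero by [ri] and shorter than [phi p], whose
   size is that of [p]. *)
have ndvd : ~~ (phi p %| phi q ^+ size (phi p)).
  apply/negP => dvd; have : phi p %| phi r.
    have -> : r = lead_coef p ^+ M *: q ^+ size p - h * p.
      by rewrite div_eq addrC addKr.
    rewrite /phi rmorphB rmorphM /= dvdp_sub ?dvdp_mull //.
    by rewrite -mul_polyC rmorphM /= dvdp_mull // rmorphXn /= -[X in _ ^+ X]sphip.
  move=> pr; have := dvdp_leq _ pr; rewrite sphip leqNgt.
  have -> : (size (phi r) < size p)%N.
    by apply: leq_ltn_trans sr; exact: size_poly.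
  have [phir0 _|_ /(_ isT)//] := eqVneq (phi r) 0.
  case/negP: ri; rewrite -residue_eq0 -coef_map.
  by rewrite -[map_poly _ _]/(phi r) phir0 coef0.
have [d irr_d /andP [dp dq]] := prime_of_ndvdp phip0 ndvd.
have d1 : size d != 1 by case: irr_d => [d1 _]; rewrite neq_ltn d1 orbT.
exists (point_over (residue Q) d1 (irreducible_prime irr_d)); last first.
  by rewrite contraction_point_over kernel_residue.
by split=> // f; rewrite inE => /eqP ->.
Qed.

(** * Shortening polynomials at their leading terms *)

Definition drop_lead p : {poly R} := p - lead_coef p *: 'X^((size p).-1).

Lemma size_drop_lead p : p != 0 -> (size (drop_lead p) < size p)%N.
Proof.
move=> p0; rewrite -[X in (_ < X)%N]prednK ?size_poly_gt0 // ltnS.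
apply/leq_sizeP => j; rewrite leq_eqVlt coefB coefZ coefXn.
move=> /orP [/eqP <-|jp]; first by rewrite eqxx mulr1 subrr.
rewrite gtn_eqF // mulr0 subr0 nth_default //.
by rewrite -[X in (X <= _)%N]prednK ?size_poly_gt0.
Qed.

Lemma mem_drop_lead p (P : spec {poly R}) : (lead_coef p)%:P \in P ->
  (drop_lead p \in P) = (p \in P).
Proof.
by move=> aP; rewrite /drop_lead rpredBr // -mul_polyC mulrC idealMr.
Qed.

(** One step of the pseudo-division of [p1] by [p2], meant for [size p2 <= size p1]. *)
Definition cancel_lead p1 p2 : {poly R} :=
  lead_coef p2 *: p1 - lead_coef p1 *: 'X^(size p1 - size p2) * p2.

Lemma size_cancel_lead p1 p2 : p1 != 0 -> p2 != 0 -> (size p2 <= size p1)%N ->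
  (size (cancel_lead p1 p2) < size p1)%N.
Proof.
move=> p10 p20 p21; rewrite -[X in (_ < X)%N]prednK ?size_poly_gt0 // ltnS.
apply/leq_sizeP => j; rewrite leq_eqVlt coefB -scalerAl !coefZ coefXnM.
have s20 : (0 < size p2)%N by rewrite size_poly_gt0.
case/orP => [/eqP <-|jp].
  rewrite ifF; last by lia.
  have -> : ((size p1).-1 - (size p1 - size p2) = (size p2).-1)%N by lia.
  by rewrite !lead_coefE mulrC subrr.
rewrite ifF; last by lia.
have {}jp : (size p1 <= j)%N by rewrite -[X in (X <= _)%N]prednK ?size_poly_gt0.
have -> : p1`_j = 0 by rewrite nth_default.
have -> : p2`_(j - (size p1 - size p2)) = 0.
  by rewrite nth_default // -{1}(subKn p21) leq_sub2r.
by rewrite !mulr0 subrr.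
Qed.

Lemma mem_cancel_lead p1 p2 (P : spec {poly R}) :
  (lead_coef p2)%:P \notin P -> p2 \in P ->
  (cancel_lead p1 p2 \in P) = (p1 \in P).
Proof.
move=> aP p2P; rewrite /cancel_lead rpredBr; last by rewrite idealMr.
by rewrite -mul_polyC prime_idealrM (negPf aP).
Qed.

(* Each step replaces one polynomial by a smaller one, so that the measure
   decreases; adding 1 to each size lets zero polynomials be discarded too. *)
Lemma proj_basic s q : fin_constructible (proj s q).
Proof.
have [n] := ubnP (\sum_(p <- s) (size p).+1).
elim: n s => // n IHn [|p s] sn.
  by rewrite proj_basic_nil; exact: fin_constructible_coefs.
have [p0|p0] := eqVneq p 0.
  have -> : proj (p :: s) q = proj s q.
    rewrite /proj; congr (_ @` _); apply/seteqP;
      split=> P /= [sP qP]; split=> // f.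
      by move=> fs; apply: sP; rewrite inE fs orbT.
    by rewrite inE => /orP [/eqP ->|/sP//]; rewrite p0 rpred0.
  by apply: IHn; move: sn; rewrite big_cons ltnS; apply: leq_trans;
    rewrite addSn ltnS leq_addl.
case: s sn => [|p2 s] sn.
  (* Where the leading coefficient vanishes the top term is dropped; elsewhere the pseudo-remainder
     decides. *)
  rewrite (@proj_basic_split (lead_coef p) _ [:: drop_lead p] [:: p]) //.
    apply: fin_constructibleU.
      apply: fin_constructibleI_closed; apply: IHn; move: sn.
      rewrite !big_cons big_nil !addn0 ltnS; apply: leq_trans.
      exact: size_drop_lead.
    rewrite proj_basic_single //; apply: fin_constructibleI_open.
    exact: fin_constructible_coefs.
  move=> P aP; split=> -[sP qP]; split=> // f; rewrite inE => /eqP ->.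
    by rewrite mem_drop_lead // sP // inE.
  by rewrite -mem_drop_lead // sP // inE.
(* Where the leading coefficient of [p2'] vanishes, [p2'] loses its top term; elsewhere [p2'] serves
   to shorten [p1]. *)
have main p1 p2' t : p1 != 0 -> p2' != 0 -> (size p2' <= size p1)%N ->
    (\sum_(f <- [:: p1, p2' & t]) (size f).+1 < n.+1)%N ->
    fin_constructible (proj [:: p1, p2' & t] q).
  move=> p10 p20 p21 tn.
  rewrite (@proj_basic_split (lead_coef p2') _ [:: p1, drop_lead p2' & t]
             [:: cancel_lead p1 p2', p2' & t]).
  - apply: fin_constructibleU.
      apply: fin_constructibleI_closed; apply: IHn; move: tn.
      by rewrite !big_cons; have := size_drop_lead p20; lia.
    apply: fin_constructibleI_open; apply: IHn; move: tn.
    by rewrite !big_cons; have := size_cancel_lead p10 p20 p21; lia.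
  - move=> P aP; split=> -[sP qP]; split=> // f; rewrite !inE.
      move=> /or3P [/eqP ->|/eqP ->|ft]; rewrite ?mem_drop_lead //;
        by apply: sP; rewrite !inE ?eqxx ?ft ?orbT.
    move=> /or3P [/eqP ->|/eqP ->|ft]; rewrite -?(mem_drop_lead aP) //;
      by apply: sP; rewrite !inE ?eqxx ?ft ?orbT.
  - move=> P aP; split=> -[sP qP].
      have p2P : p2' \in P by apply: sP; rewrite !inE eqxx orbT.
      split=> // f; rewrite !inE => /or3P [/eqP ->|/eqP ->//|ft].
        by rewrite mem_cancel_lead //; apply: sP; rewrite inE eqxx.
      by apply: sP; rewrite !inE ft !orbT.
    have p2P : p2' \in P by apply: sP; rewrite !inE eqxx orbT.
    split=> // f; rewrite !inE => /or3P [/eqP ->|/eqP ->//|ft].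
      by rewrite -(mem_cancel_lead p1 aP p2P); apply: sP; rewrite inE eqxx.
    by apply: sP; rewrite !inE ft !orbT.
have [p20|p20] := eqVneq p2 0.
  have -> : proj [:: p, p2 & s] q = proj (p :: s) q.
    rewrite /proj; congr (_ @` _); apply/seteqP;
      split=> P /= [sP qP]; split=> // f.
      by rewrite inE => /orP [/eqP ->|fs]; apply: sP;
        rewrite !inE ?eqxx ?fs ?orbT.
    rewrite !inE => /or3P [/eqP ->|/eqP ->|fs].
    - by apply: sP; rewrite inE eqxx.
    - by rewrite p20 rpred0.
    - by apply: sP; rewrite inE fs orbT.
  by apply: IHn; move: sn; rewrite !big_cons; lia.
have [le21|lt12] := leqP (size p2) (size p); first exact: main.
have -> : proj [:: p, p2 & s] q = proj [:: p2, p & s] q.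
  rewrite /proj; congr (_ @` _); apply/seteqP; split=> P /= [sP qP]; split=> // f;
    by rewrite !inE orbCA => fs; apply: sP; rewrite !inE.
by apply: main => //; [exact: ltnW|move: sn; rewrite !big_cons; lia].
Qed.

End LineProjection.

Lemma fin_constructible_line (R : comNzRingType) (A : set (spec {poly R})) :
  fin_constructible A -> fin_constructible (contraction (@polyC R) @` A).
Proof.
elim=> [s q|{}A B _ hA _ hB]; first exact: proj_basic.
by rewrite image_setU; exact: fin_constructibleU.
Qed.

(** * Iterated polynomial rings *)

(** Variables are adjoined one at a time, so that results on [{poly R}] extend to [n] variables by
    induction. *)
Fixpoint iter_poly (R : comNzRingType) (n : nat) : comNzRingType :=
  if n is n'.+1 then {poly iter_poly R n'} else R.

Fixpoint iter_polyC (R : comNzRingType) (n : nat) :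
    {rmorphism R -> iter_poly R n} :=
  if n is n'.+1 then
    (@polyC (iter_poly R n') \o iter_polyC R n' : {rmorphism _ -> _})
  else (idfun : {rmorphism R -> R}).

(** The outermost variable has index [n - 1], and an index out of range gives 0. Natural numbers as
    indices stay the same at every stage of the recursion. *)
Fixpoint iter_polyX (R : comNzRingType) (n i : nat) : iter_poly R n :=
  if n is n'.+1 then (if i == n' then 'X else (iter_polyX R n' i)%:P) else 0.

Lemma commr_rmorph_com (R S : comNzRingType) (phi : {rmorphism R -> S}) (x : S) :
  commr_rmorph phi x.
Proof. by move=> a; exact: mulrC. Qed.

Section Eval.
Variables (R S : comNzRingType) (phi : {rmorphism R -> S}) (x : nat -> S).

Fixpoint iter_eval (n : nat) : {rmorphism iter_poly R n -> S} :=
  if n is n'.+1 then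
    (horner_morph (commr_rmorph_com (iter_eval n') (x n'))
       : {rmorphism {poly iter_poly R n'} -> S})
  else phi.

Lemma iter_evalC n a : iter_eval n (iter_polyC R n a) = phi a.
Proof. by elim: n => //= n IHn; rewrite horner_morphC. Qed.

Lemma iter_evalX n i : (i < n)%N -> iter_eval n (iter_polyX R n i) = x i.
Proof.
elim: n => //= n IHn; rewrite ltnS leq_eqVlt; case: eqVneq => [-> _|_ /= lt_in].
  by rewrite horner_morphX.
by rewrite horner_morphC IHn.
Qed.

End Eval.

Lemma noetherian_iter_poly (R : comNzRingType) n :
  noetherian R -> noetherian (iter_poly R n).
Proof. by move=> noeR; elim: n => //= n; exact: noetherian_poly. Qed.

(** Contraction along a composite is the composite of the contractions, so the variables are
    eliminated singly, the outermost first. *)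
Lemma fin_constructible_projection (R : comNzRingType) n
    (A : set (spec (iter_poly R n))) :
  fin_constructible A -> fin_constructible (contraction (iter_polyC R n) @` A).
Proof.
elim: n A => [|n IHn] A hA /=.
  suff -> : contraction idfun @` A = A by [].
  have idE (P : spec R) : contraction idfun P = P by exact: spec_ext.
  by apply/seteqP; split=> [_ [P AP <-]|P AP]; [rewrite idE|exists P].
have -> : contraction (polyC \o iter_polyC R n) @` A
    = contraction (iter_polyC R n) @` (contraction polyC @` A).
  have compE (P : spec {poly iter_poly R n}) :
      contraction (polyC \o iter_polyC R n) P
      = contraction (iter_polyC R n) (contraction polyC P) by exact: spec_ext.
  rewrite image_comp; congr image; apply: funext => P; exact: compE.
by apply: IHn; exact: fin_constructible_line.
Qed.

(** * Comparison with multivariate polynomials *)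

Lemma mpoly_ring_ind (k : comNzRingType) n (Pr : {mpoly k[n]} -> Prop) :
    (forall c, Pr c%:MP) -> (forall i, Pr 'X_i) ->
    (forall f g, Pr f -> Pr g -> Pr (f + g)) ->
    (forall f g, Pr f -> Pr g -> Pr (f * g)) ->
  forall f, Pr f.
Proof.
move=> PrC PrX PrD PrM; elim/mpolyind => [|c m f _ _ Prf]; first exact: (PrC 0).
apply: PrD => //; rewrite -mul_mpolyC; apply: (PrM) => //.
rewrite mpolyXE_id; apply: (big_ind Pr (PrC 1) PrM).
move=> i _; elim: (m i) => [|e IHe]; first by rewrite expr0; exact: (PrC 1).
by rewrite exprS; apply: PrM.
Qed.

Lemma mpoly_rmorph_ext (k S : comNzRingType) n
    (f g : {rmorphism {mpoly k[n]} -> S}) :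
  (forall c, f c%:MP = g c%:MP) -> (forall i, f 'X_i = g 'X_i) -> f =1 g.
Proof.
move=> fgC fgX; apply: mpoly_ring_ind => // u v fu fv.
  by rewrite !rmorphD fu fv.
by rewrite !rmorphM fu fv.
Qed.

(** Evaluating iterated polynomials at the variables is onto, since the image is a subring
    containing the constants and the variables. *)
Lemma noetherian_mpoly (k : fieldType) n : noetherian {mpoly k[n]}.
Proof.
pose x (i : nat) : {mpoly k[n]} :=
  if insub i is Some j then 'X_(j : 'I_n) else 0.
have xE (i : 'I_n) : x i = 'X_i by rewrite /x valK.
apply: (@noetherian_surj _ _ (iter_eval (@mpolyC n k) x n)); last first.
  exact/noetherian_iter_poly/noetherian_field.
apply: mpoly_ring_ind => [c|i|_ _ [a <-] [b <-]|_ _ [a <-] [b <-]].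
- by exists (iter_polyC k n c); rewrite iter_evalC.
- by exists (iter_polyX k n i); rewrite iter_evalX.
- by exists (a + b); rewrite rmorphD.
- by exists (a * b); rewrite rmorphM.
Qed.

(** * Images under tuples of fractions *)

(* A point of [T] is a prime of k[y_1, ..., y_m][x_1, ..., x_n]; [graph_eqs] are
   the equations of [s] in x together with q_i(x) y_i = p_i(x). *)
Section FractionImage.
Variables (k : fieldType) (n m : nat).
Variables (s : seq {mpoly k[n]}) (p q : 'I_m -> {mpoly k[n]}).

(** A vanishing denominator yields the coordinate 0 by convention; the point is meaningful where no
    [q i] lies in [P]. *)
Definition fraction_point (P : affine_space k n) : affine_space k m :=
  point_of (residue_scalar P) (fun i => residue P (p i) / residue P (q i)).

Definition fraction_dom : set (affine_space k n) := basic s (\prod_i q i).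

Let T := iter_poly {mpoly k[m]} n.
Let iota : {rmorphism {mpoly k[n]} -> T} :=
  mmap (iter_polyC {mpoly k[m]} n \o @mpolyC m k)
       (fun i => iter_polyX {mpoly k[m]} n i).
Let kappa : {rmorphism {mpoly k[m]} -> T} := iter_polyC {mpoly k[m]} n.

Definition graph_eqs : seq T :=
  map iota s ++ [seq iota (q i) * kappa 'X_i - iota (p i) | i <- enum 'I_m].

Lemma dom_den (P : affine_space k n) i : fraction_dom P -> q i \notin P.
Proof.
by case=> _; rewrite (bigD1 i) //= prime_idealrM negb_or => /andP [].
Qed.

(** On the graph the y-coordinates are forced to be the fractions, as no [q i] vanishes there. *)
Lemma fraction_pointE (PP : spec T) :
  basic graph_eqs (iota (\prod_i q i)) PP ->
  contraction kappa PP = fraction_point (contraction iota PP).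
Proof.
move=> [eqs qPP]; set P := contraction iota PP.
set v := fun i => residue P (p i) / residue P (q i).
have qP i : q i \notin P.
  by move: qPP; rewrite (bigD1 i) //= rmorphM prime_idealrM negb_or => /andP [].
have graphP i : iota (q i) * kappa 'X_i - iota (p i) \in PP.
  apply: eqs; rewrite mem_cat; apply/orP; right; apply/mapP.
  by exists i; rewrite ?mem_enum.
(* Avoids comparing the residue fields of P and PP: for h in k[y], h(v) = H / D
   in that of P, while D h = H modulo PP. *)
have clear_den (h : {mpoly k[m]}) : exists (H D : {mpoly k[n]}), [/\ D \notin P,
    mmap (residue_scalar P) v h * residue P D = residue P H
    & iota D * kappa h - iota H \in PP].
  elim/mpoly_ring_ind: h => [c|i|f g [F [D [DP fE fP]]] [G [E [EP gE gP]]]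
                                |f g [F [D [DP fE fP]]] [G [E [EP gE gP]]]].
  - exists c%:MP, 1; split; first by rewrite idealr1.
      by rewrite mmapC rmorph1 mulr1.
    rewrite rmorph1 mul1r /iota /= mmapC /= /kappa subrr.
    exact: rpred0.
  - exists (p i), (q i); split=> //.
    by rewrite mmapX mmap1U /v divfK // residue_eq0.
  - exists (F * E + G * D), (D * E); split.
    + by rewrite prime_idealrM negb_or DP.
    + by rewrite !rmorphD !rmorphM /= -fE -gE; ring.
    + have := rpredD (idealMr (iota E) fP) (idealMr (iota D) gP).
      by rewrite !rmorphD !rmorphM; congr (_ \in PP); ring.
  - exists (F * G), (D * E); split.
    + by rewrite prime_idealrM negb_or DP.
    + by rewrite !rmorphM /= -fE -gE; ring.
    + have := rpredD (idealMr (iota E * kappa g) fP) (idealMr (iota F) gP).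
      by rewrite !rmorphM; congr (_ \in PP); ring.
apply: spec_ext => h; rewrite mem_contraction.
rewrite -[RHS]/(mmap (residue_scalar P) v h == 0).
(* As [D] is not in [P], both sides amount to [H] lying in [P]. *)
have [H [D [DP hE hP]]] := clear_den h.
have D0 : residue P D != 0 by rewrite residue_eq0.
rewrite -(mulIr_eq0 _ (mulIf D0)) hE residue_eq0 mem_contraction.
rewrite -[iota H](subKr (iota D * kappa h)) rpredBr // prime_idealrM.
by rewrite -(mem_contraction iota PP D) (negPf DP).
Qed.

(** The y-variables are evaluated at an arbitrary [v], then the x-variables as [e] prescribes;
    scalars go through [e] in both. *)
Lemma graph_morphism (K : fieldType) (e : {rmorphism {mpoly k[n]} -> K})
    (v : 'I_m -> K) :
  exists psi : {rmorphism T -> K}, (forall h, psi (iota h) = e h)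
    /\ (forall h, psi (kappa h) = mmap (e \o @mpolyC n k) v h).
Proof.
pose x (j : nat) : K := if insub j is Some j' then e 'X_(j' : 'I_n) else 0.
have xE (j : 'I_n) : x j = e 'X_j by rewrite /x valK.
pose psi := iter_eval (mmap (e \o @mpolyC n k) v) x n.
have psi_kappa h : psi (kappa h) = mmap (e \o @mpolyC n k) v h.
  by rewrite /psi iter_evalC.
exists psi; split=> //.
have : psi \o iota =1 e; last by [].
apply: mpoly_rmorph_ext => [c|i] /=.
  by rewrite mmapC /= psi_kappa mmapC.
by rewrite mmapX mmap1U /psi iter_evalX.
Qed.

(** The lift is the kernel of the evaluation, in the residue field of [P], of x at [P] and of y at
    the fractions. *)
Lemma graph_lift (P : affine_space k n) : fraction_dom P ->
  exists2 PP : spec T, basic graph_eqs (iota (\prod_i q i)) PP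
    & contraction iota PP = P /\ contraction kappa PP = fraction_point P.
Proof.
move=> domP; have [sP qP] := domP.
pose v i := residue P (p i) / residue P (q i).
have [psi [psi_iota psi_kappa]] := graph_morphism (residue P) v.
have iotaP : contraction iota (kernel_point psi) = P.
  by rewrite (contraction_kernel psi_iota) kernel_residue.
exists (kernel_point psi); last first.
  by split=> //; exact: (contraction_kernel psi_kappa).
split=> [f|]; last by rewrite -mem_contraction iotaP.
rewrite mem_cat => /orP [/mapP [a as_ ->]|/mapP [i _ ->]].
  by rewrite -mem_contraction iotaP; exact: sP.
rewrite mem_kernel rmorphB rmorphM psi_kappa !psi_iota mmapX mmap1U.
by rewrite mulrC divfK ?subrr // residue_eq0; exact: dom_den.
Qed.

Lemma fin_constructible_fraction :
  fin_constructible (fraction_point @` fraction_dom).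
Proof.
have -> : fraction_point @` fraction_dom
    = contraction kappa @` basic graph_eqs (iota (\prod_i q i)).
  apply/seteqP; split=> [_ [P domP <-]|_ [PP hPP <-]].
    by have [PP hPP [_ <-]] := graph_lift domP; exists PP.
  rewrite fraction_pointE //; exists (contraction iota PP) => //.
  case: hPP => eqs qPP; split=> // a as_.
  by rewrite mem_contraction; apply: eqs; rewrite mem_cat map_f.
apply: fin_constructible_projection; exact: fin_constructible_basic.
Qed.

End FractionImage.

(** * Return to the Zariski topology *)

Section Constructible.
Variable T : topologicalType.

Lemma locally_closed_constructible (A : set T) :
  locally_closed A -> constructible A.
Proof.
move=> hA; exists 1%N, (fun=> A); split=> //.
by apply/seteqP; split=> [x Ax|x [] //]; exists ord0.
Qed.

Lemma constructibleU (A B : set T) :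
  constructible A -> constructible B -> constructible (A `|` B).
Proof.
move=> [a [F [Flc ->]]] [b [G [Glc ->]]].
exists (a + b)%N,
  (fun i => match fintype.split i with inl j => F j | inr j => G j end).
split=> [i|]; first by case: (fintype.split i).
apply/seteqP; split=> x.
  move=> [[i _ Fx]|[i _ Gx]].
    by exists (unsplit (inl i)) => //; rewrite unsplitK.
  by exists (unsplit (inr i)) => //; rewrite unsplitK.
by move=> [i _]; case: (fintype.split i) => j; [left|right]; exists j.
Qed.

End Constructible.

(** A basic set is the intersection of an open and a closed set. Preimages allow passing to the
    subspace [Y] along its inclusion. *)
Lemma fin_constructible_preimage (R : comNzRingType) (T : topologicalType)
    (g : T -> spec R) (A : set (spec R)) :
  continuous g -> fin_constructible A -> constructible (g @^-1` A).
Proof.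
move=> gcont; have /continuousP gopen := gcont;
elim=> [s q|{}A B _ hA _ hB]; last exact: constructibleU.
apply: locally_closed_constructible.
exists (g @^-1` (~` zero_locus [set q])), (g @^-1` zero_locus [set` s]); split.
- by apply: gopen; exists [set q].
- apply: closed_comp => [x _|]; first exact: gcont.
  by rewrite -openC; exists [set` s].
- apply/seteqP; split=> x /=; rewrite /basic /zero_locus /=.
    by move=> [sx qx]; split=> // /(_ q erefl); exact/negP.
  by move=> [qx sx]; split=> //; apply/negP => qx'; apply: qx => _ ->.
Qed.

(** * Rational maps *)

(** Taking [s] inside [S] matters when [S] consists of products of denominators: each member of [s]
    then comes from a tuple of representatives. *)
Lemma noetherian_zero_locus (R : comNzRingType) (S : set R) : noetherian R ->
  exists2 s : seq R, [set` s] `<=` S & zero_locus S = zero_locus [set` s].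
Proof.
move=> noeR; have [s sS Ss] := noetherian_subset S noeR; exists s => //.
apply/seteqP; split=> P /= SP a; first by move/sS; exact: SP.
by move/Ss => /(_ _ (spec_ideal P) SP).
Qed.

Lemma closed_zero_locus (R : comNzRingType) (Z : set (spec R)) :
  closed Z -> exists S : set R, Z = zero_locus S.
Proof.
by rewrite -openC => -[S ZS]; exists S; rewrite -[Z]setCK ZS setCK.
Qed.

Lemma closed_subtype (T : topologicalType) (X : set T) (C : set X) :
  closed C -> exists2 Z : set T, closed Z & C = \val @^-1` Z.
Proof.
rewrite -openC => -[U oU UC]; exists (~` U); first by rewrite closedC.
by rewrite preimage_setC -[LHS]setCK -UC.
Qed.

(** Values at points of [X] are unique, so any representatives with denominators nonzero at [P]
    compute the image. *)
Lemma maps_to_fraction_point (k : fieldType) (n m : nat)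
    (X : set (affine_space k n)) (b c : 'I_m -> fraction_on X)
    (P : affine_space k n) (Q : affine_space k m) :
    X P -> (forall i, same_function (b i) (c i)) ->
    (forall i, den (c i) \notin P) ->
  maps_to b P Q <->
    fraction_point (fun i => num (c i)) (fun i => den (c i)) P = Q.
Proof.
move=> XP bc cP.
have val_c i : has_value (b i) (residue P (num (c i)) / residue P (den (c i))).
  by exists (c i).
split=> [[v [bv ->]]|<-].
  rewrite /fraction_point; congr point_of; apply: funext => i.
  exact: has_value_unique XP (val_c i) (bv i).
by exists (fun i => residue P (num (c i)) / residue P (den (c i))).
Qed.

Theorem theorem1p2 (k : fieldType) (n m : nat)
    (X : set (affine_space k n)) (Y : set (affine_space k m))
    (hX : closed X) (hY : closed Y)
    (f : rational_map X Y) (C : set X) (hC : closed C) :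
  constructible (rational_image f C).
Proof.
have noe := @noetherian_mpoly k n.
have [Z hZ CZ] := closed_subtype hC.
have [s sE] : exists s : seq {mpoly k[n]}, X `&` Z = zero_locus [set` s].
  have [S ->] := closed_zero_locus (closedI hX hZ).
  by have [s _ ->] := noetherian_zero_locus S noe; exists s.
pose represents (c : 'I_m -> fraction_on X) :=
  forall i, same_function (coords f i) (c i).
(* The domain of definition is the union of the nonvanishing loci of these
   denominators; finitely many of them suffice. *)
have [t tS tE] := noetherian_zero_locus
  [set d | exists2 c, represents c & d = \prod_i den (c i)] noe.
(* Outside [t] the coordinates of [f] itself serve as default tuple. *)
have /choice [rep repP] : forall d, exists c, represents c /\
    (d \in t -> d = \prod_i den (c i)).
  move=> d; have [dt|_] := boolP (d \in t); last first.
    by exists f; split=> // i P _; rewrite subrr rpred0.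
  by have [c fc dE] := tS d dt; exists c.
pose piece d := fraction_point (fun i => num (rep d i)) (fun i => den (rep d i))
  @` fraction_dom s (fun i => den (rep d i)).
have -> : rational_image f C = \val @^-1` [set Q : spec {mpoly k[m]} |
    exists2 d, d \in t & piece d Q].
  apply/seteqP; split=> y /=.
    move=> [x [Cx fxy]]; have Xx : X (\val x) by exact: set_valP.
    have Px : zero_locus [set` s] (\val x).
      by rewrite -sE; split=> //; move: Cx; rewrite CZ.
    (* If all of [t] vanished at [x], so would the product of denominators of every representing
       tuple, yet [maps_to] supplies a tuple with no denominator vanishing at [x]. *)
    have [d dt dx] : exists2 d, d \in t & d \notin (\val x : spec _).
      apply: contrapT => nd; have : zero_locus [set` t] (\val x).
        move=> d dt; apply: contrapT => /negP dx; apply: nd; by exists d.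
      rewrite -tE => tx; have [v [vP _]] := fxy.
      have /choice [c cP] := vP.
      have /negP[] : \prod_i den (c i) \notin (\val x : spec _).
        apply: (big_ind (fun g => g \notin (\val x : spec _))).
        - by rewrite idealr1.
        - by move=> g h gx hx; rewrite prime_idealrM negb_or gx.
        - by move=> i _; case: (cP i).
      by apply: tx; exists c => // i; case: (cP i).
    have [fd dE] := repP d; exists d => //; exists (\val x).
      by split=> //; rewrite -dE.
    apply/(maps_to_fraction_point _ Xx fd) => // i.
    by apply: (@dom_den _ _ _ s (fun i => den (rep d i))); split=> //; rewrite -dE.
  move=> [d dt [P domP Py]]; have [fd dE] := repP d.
  have [XP ZP] : (X `&` Z) P by rewrite sE; exact: domP.1.
  exists (SigSub (mem_set XP)); split; first by rewrite CZ.
  apply/(maps_to_fraction_point _ XP fd) => // i.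
  exact: dom_den domP.
apply: fin_constructible_preimage; first exact: initial_continuous.
by apply: fin_constructible_bigU => d; exact: fin_constructible_fraction.
Qed.
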